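(* Let $\phi \in C^1(\mathbb{R}^2,\mathbb{R})$ be a strictly star-shaped function. Then the planar system $$\dot x = y, \qquad \dot y = -x - y\,\phi(x,y)$$ has at most one limit cycle.
   Context: Subscripts denote partial derivatives. A function $\phi\in C^1(\mathbb{R}^2,\mathbb{R})$ is called strictly star-shaped if $x\phi_x(x,y) + y\phi_y(x,y) \neq 0$ for every $(x,y)\neq(0,0)$. A limit cycle is an isolated non-constant periodic orbit of the system, i.e. a non-constant periodic orbit having a neighbourhood that contains no other periodic orbit. Limit cycles are counted as orbits (closed curves in the plane). The system is equivalent to the second order equation $\ddot x + \dot x\,\phi(x,\dot x) + x = 0$. *)

(* Defs.v *)
From Stdlib Require Import Reals.
From Coquelicot Require Import Coquelicot.

Open Scope R_scope.

Definition C1_plane (phi : R -> R -> R) : Prop :=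
  forall x y : R,
    ex_derive (fun u => phi u y) x /\
    ex_derive (fun v => phi x v) y /\
    continuity_2d_pt (fun u v => Derive (fun w => phi w v) u) x y /\
    continuity_2d_pt (fun u v => Derive (fun w => phi u w) v) x y.

Definition strictly_star_shaped (phi : R -> R -> R) : Prop :=
  forall x y : R, (x, y) <> (0, 0) ->
    x * Derive (fun u => phi u y) x + y * Derive (fun v => phi x v) y <> 0.

Definition solution (F : R * R -> R * R) (gamma : R -> R * R) : Prop :=
  forall t : R, is_derive gamma t (F (gamma t)).

(* Orbits are subsets of the plane, so that time translates of one solution
   give the same orbit. Equilibria count as (constant) periodic orbits. *)
Definition periodic_orbit (F : R * R -> R * R) (C : R * R -> Prop) : Prop :=
  exists (gamma : R -> R * R) (T : R),
    0 < T /\ solution F gamma /\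
    (forall t : R, gamma (t + T) = gamma t) /\
    (forall p : R * R, C p <-> exists t : R, gamma t = p).

Definition limit_cycle (F : R * R -> R * R) (C : R * R -> Prop) : Prop :=
  periodic_orbit F C /\
  (exists p q : R * R, C p /\ C q /\ p <> q) /\
  exists U : R * R -> Prop,
    open U /\ (forall p, C p -> U p) /\
    forall D : R * R -> Prop,
      periodic_orbit F D -> (forall p, D p -> U p) -> forall p, D p <-> C p.

Definition vector_field (phi : R -> R -> R) (p : R * R) : R * R :=
  (snd p, - fst p - snd p * phi (fst p) (snd p)).

(* Main.v *)
Require Import Defs.
From Stdlib Require Import Reals Lra Lia ZArith Ranalysis5 ClassicalEpsilon.
From Coquelicot Require Import Coquelicot.

Open Scope R_scope.

(** The radial derivative of [phi] is continuous and never zero on the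
    punctured plane, which is connected, so it has one sign there: along every
    ray [phi] is strictly increasing, or along every ray strictly decreasing.
    Reversing time ([cycle_time_reversal]) exchanges the two cases, so let
    [phi] be radially increasing.

    The linear part of the field commutes with dilations. Hence, if [g] is a
    periodic orbit and [K > 1], the dilated curve [K * g] solves the same
    equation with [phi (p / K)] in place of [phi p], a smaller friction. Let
    [g1], [g2] be non-constant periodic orbits and let [K] be the largest
    ratio with which a point of [g2] is a dilation of a point of [g1]; it
    exists by compactness ([ray_ratio_sup_attained]), because non-constant
    orbits stay away from the origin ([origin_is_rest]). Suppose [K > 1].

    As [x' = y], each part of an orbit in the upper half-plane is the graph of
    a function of [x] ([upper_arc_through]), above an interval which contains
    0 in its interior. Let [f1] and [f2] be such arcs of [g1] and [g2]
    through the extremal points. If [f2] exceeded the dilated arc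
    [w => K * f1 (w / K)] somewhere, the segment from the origin to that point
    of [f2] would cross the dilated arc, and the ratio there would be larger
    than [K]. So [f2] lies below the dilated arc and touches it. On the
    upper arcs [dy/dx = - x / y - phi], so at a common point the slope of the
    dilated arc is larger by the gap of [phi] between the two dilated points,
    which excludes a tangency with [y > 0] ([arcs_touch_inside]); at a common
    right end, where both slopes are infinite, the sign of the difference of
    the slopes just before the end gives the contradiction
    ([arcs_touch_right_end]). Touching points in the lower half-plane and at
    left ends are moved to these cases by the symmetry [p => - p]. Hence
    [K <= 1] ([ray_ratio_le_one]).

    Exchanging [g1] and [g2] shows that two points of the two orbits on one ray
    through the origin are equal. Since every ray meets every non-constant
    periodic orbit ([cycle_meets_ray]), the two orbits coincide. *)

(** * Real functions of one variable *)

Lemma is_derive_continuous (f : R -> R) (t l : R) :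
  is_derive f t l -> continuous f t.
Proof.
  intros H; apply (ex_derive_continuous f); now exists l.
Qed.

Lemma is_derive_linear (k t : R) : is_derive (fun s => k * s) t k.
Proof.
  auto_derive; [exact I | ring].
Qed.

Lemma mean_value (f df : R -> R) (a b : R) :
  a < b ->
  (forall t, a <= t <= b -> continuous f t) ->
  (forall t, a < t < b -> is_derive f t (df t)) ->
  exists c, a < c < b /\ f b - f a = df c * (b - a).
Proof.
  intros Hab Hc Hd.
  assert (pr : forall c, a < c < b -> derivable_pt f c).
  { intros c Hcab; exists (df c); apply is_derive_Reals; auto. }
  destruct (MVT f id a b pr (fun c _ => derivable_pt_id c) Hab) as [c [P E]].
  - intros c Hcab; apply continuity_pt_filterlim, Hc, Hcab.
  - intros c _; apply derivable_continuous_pt, derivable_pt_id.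
  - exists c; split; [exact P|].
    assert (E1 : derive_pt f c (pr c P) = df c).
    { apply derive_pt_eq_0, is_derive_Reals; auto. }
    assert (E2 : derive_pt id c (derivable_pt_id c) = 1).
    { apply derive_pt_eq_0, derivable_pt_lim_id. }
    rewrite E1, E2 in E; unfold id in E; lra.
Qed.

Lemma intermediate_zero (f : R -> R) (a b : R) :
  a < b -> (forall t, a <= t <= b -> continuous f t) ->
  f a * f b < 0 -> exists c, a < c < b /\ f c = 0.
Proof.
  intros Hab Hc Hs.
  assert (Hc' : forall t, a <= t <= b -> continuity_pt f t).
  { intros t Ht; apply continuity_pt_filterlim, Hc, Ht. }
  destruct (Rtotal_order (f a) 0) as [Ha|[Ha|Ha]].
  - destruct (IVT_interv f a b Hc' Hab Ha) as [c [Hcab E]]; [nra|].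
    exists c; split; [|exact E].
    assert (c <> a) by (intros ->; lra).
    assert (c <> b) by (intros ->; rewrite E in Hs; lra).
    lra.
  - rewrite Ha in Hs; lra.
  - destruct (IVT_interv (fun t => - f t) a b) as [c [Hcab E]]; try nra.
    + intros t Ht; apply continuity_pt_opp, Hc', Ht.
    + exists c; split; [|lra].
      assert (E' : f c = 0) by lra.
      assert (c <> a) by (intros ->; lra).
      assert (c <> b) by (intros ->; rewrite E' in Hs; lra).
      lra.
Qed.

(** The inverse is extended by constants outside [[x t0, x t1]], which makes it
    continuous on the whole line although the speed [y] may vanish at [t0] and
    [t1]. *)
Lemma increasing_inverse (x y : R -> R) (t0 t1 : R) :
  t0 < t1 ->
  (forall t, is_derive x t (y t)) ->
  (forall t, t0 < t < t1 -> 0 < y t) ->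
  exists tau : R -> R,
    (forall u, t0 <= tau u <= t1) /\
    (forall t, t0 <= t <= t1 -> tau (x t) = t) /\
    (forall u, x t0 <= u <= x t1 -> x (tau u) = u) /\
    (forall u, u <= x t0 -> tau u = t0) /\
    (forall u, x t1 <= u -> tau u = t1) /\
    (forall u, continuous tau u) /\
    (forall u, x t0 < u < x t1 -> is_derive tau u (/ y (tau u))).
Proof.
  intros Ht Hx Hy.
  assert (Hxc : forall t, continuous x t)
    by (intros t; apply (is_derive_continuous _ _ _ (Hx t))).
  assert (Hinc : forall s t, t0 <= s -> s < t -> t <= t1 -> x s < x t).
  { intros s t Hs Hst Htt.
    destruct (mean_value x y s t Hst) as [c [Hc E]]; auto.
    assert (0 < y c) by (apply Hy; lra). nra. }
  assert (Hinj : forall s t, t0 <= s <= t1 -> t0 <= t <= t1 ->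
            x s <= x t -> s <= t).
  { intros s t Hs Htt Hst. destruct (Rle_or_lt s t) as [|Hlt]; auto.
    pose proof (Hinc t s); lra. }
  pose proof (Hinc t0 t1 ltac:(lra) Ht ltac:(lra)) as Hab.
  set (clamp := fun u => Rmax (x t0) (Rmin u (x t1))).
  assert (Hex : forall u, exists t, t0 <= t <= t1 /\ x t = clamp u).
  { intros u.
    destruct (IVT_gen x t0 t1 (clamp u)) as [t [H1 H2]].
    - intros t; apply continuity_pt_filterlim, Hxc.
    - rewrite Rmin_left, Rmax_right by lra. unfold clamp, Rmax, Rmin.
      repeat destruct Rle_dec; lra.
    - rewrite Rmin_left, Rmax_right in H1 by lra. now exists t. }
  (* Solve [x t = clamp u]: the extension by constants is built in. *)
  set (tau := fun u => proj1_sig (constructive_indefinite_description _ (Hex u))).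
  assert (Htau : forall u, t0 <= tau u <= t1 /\ x (tau u) = clamp u).
  { intros u; unfold tau; apply proj2_sig. }
  assert (Hback : forall t, t0 <= t <= t1 -> tau (x t) = t).
  { intros t Htt. destruct (Htau (x t)) as [H1 H2].
    assert (E : clamp (x t) = x t).
    { assert (x t0 <= x t <= x t1).
      { split; [destruct (Req_dec t0 t) as [<-|]|destruct (Req_dec t t1) as [->|]];
          try lra; apply Rlt_le, Hinc; lra. }
      unfold clamp; rewrite Rmin_left, Rmax_right; lra. }
    rewrite E in H2.
    apply Rle_antisym; apply Hinj; lra. }
  assert (Hcl : forall u, x t0 <= u <= x t1 -> clamp u = u).
  { intros u Hu; unfold clamp; rewrite Rmin_left, Rmax_right; lra. }
  assert (Hlow : forall u, u <= x t0 -> tau u = t0).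
  { intros u Hu. destruct (Htau u) as [H1 H2].
    assert (clamp u = x t0) by
      (unfold clamp; rewrite Rmin_left, Rmax_left; lra).
    apply Rle_antisym; apply Hinj; lra. }
  assert (Hhigh : forall u, x t1 <= u -> tau u = t1).
  { intros u Hu. destruct (Htau u) as [H1 H2].
    assert (clamp u = x t1) by
      (unfold clamp; rewrite Rmin_right, Rmax_right; lra).
    apply Rle_antisym; apply Hinj; lra. }
  assert (Hlip : forall u v, Rabs (clamp u - clamp v) <= Rabs (u - v)).
  { intros u v; unfold clamp, Rmax, Rmin, Rabs.
    repeat destruct Rle_dec; repeat destruct Rcase_abs; lra. }
  (* If [tau v] left the [eps]-ball around [tau u], then [x (tau v)] would be
     beyond [x (tau u +- eps)], while [clamp] does not increase distances. *)
  assert (Hcont : forall u, continuous tau u).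
  { intros u. apply filterlim_locally. intros eps.
    destruct (Htau u) as [Hr Hxr]. pose proof (cond_pos eps) as He.
    assert (Hright : exists d, 0 < d /\
              forall v, Rabs (v - u) < d -> tau v < tau u + eps).
    { destruct (Rle_or_lt (tau u + eps) t1) as [Hle|Hlt].
      - exists (x (tau u + eps) - x (tau u)). split.
        + pose proof (Hinc (tau u) (tau u + eps)); lra.
        + intros v Hv. apply Rnot_le_lt; intros Hge.
          assert (x (tau u + eps) <= x (tau v)).
          { destruct (Req_dec (tau u + eps) (tau v)) as [->|]; [lra|].
            apply Rlt_le, Hinc; try lra. apply Htau. }
          pose proof (Hlip v u). pose proof (proj2 (Htau v)).
          pose proof (Rle_abs (clamp v - clamp u)). lra.
      - exists 1. split; [lra|]. intros v _. pose proof (proj1 (Htau v)). lra. }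
    assert (Hleft : exists d, 0 < d /\
              forall v, Rabs (v - u) < d -> tau u - eps < tau v).
    { destruct (Rle_or_lt t0 (tau u - eps)) as [Hle|Hlt].
      - exists (x (tau u) - x (tau u - eps)). split.
        + pose proof (Hinc (tau u - eps) (tau u)); lra.
        + intros v Hv. apply Rnot_le_lt; intros Hge.
          assert (x (tau v) <= x (tau u - eps)).
          { destruct (Req_dec (tau u - eps) (tau v)) as [->|]; [lra|].
            apply Rlt_le, Hinc; try lra. apply Htau. }
          pose proof (Hlip u v) as HL. rewrite (Rabs_minus_sym u v) in HL.
          pose proof (proj2 (Htau v)).
          pose proof (Rle_abs (clamp u - clamp v)). lra.
      - exists 1. split; [lra|]. intros v _. pose proof (proj1 (Htau v)). lra. }
    destruct Hright as [d1 [Hd1 H1]]; destruct Hleft as [d2 [Hd2 H2]].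
    exists (mkposreal (Rmin d1 d2) (Rmin_pos _ _ Hd1 Hd2)).
    intros v Hv. change (Rabs (v - u) < Rmin d1 d2) in Hv.
    change (Rabs (tau v - tau u) < eps).
    pose proof (Rmin_l d1 d2); pose proof (Rmin_r d1 d2).
    specialize (H1 v ltac:(lra)); specialize (H2 v ltac:(lra)).
    apply Rabs_def1; lra. }
  assert (Hinv : forall u, x t0 <= u <= x t1 -> x (tau u) = u).
  { intros u Hu; rewrite (proj2 (Htau u)); auto. }
  exists tau.
  split; [intros u; apply Htau|]. do 5 (split; [assumption|]).
  intros u Hu.
  assert (Hin : t0 < tau u < t1).
  { pose proof (Hinv u ltac:(lra)) as E. destruct (Htau u) as [Hr _].
    assert (tau u <> t0) by (intros E'; rewrite E' in E; lra).
    assert (tau u <> t1) by (intros E'; rewrite E' in E; lra). lra. }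
  pose proof (Hy _ Hin) as Hpos.
  assert (Prf : forall a, tau (x t0) <= a <= tau (x t1) -> derivable_pt x a).
  { intros a _; exists (y a); apply is_derive_Reals, Hx. }
  assert (Prg : tau (x t0) <= tau u <= tau (x t1)).
  { rewrite !Hback by lra; lra. }
  assert (Ed : derive_pt x (tau u) (Prf (tau u) Prg) = y (tau u)).
  { apply derive_pt_eq_0, is_derive_Reals, Hx. }
  apply is_derive_Reals.
  replace (/ y (tau u)) with (1 / derive_pt x (tau u) (Prf (tau u) Prg))
    by (rewrite Ed; field; lra).
  apply derivable_pt_lim_recip_interv; auto; try lra.
  apply continuity_pt_filterlim, Hcont.
Qed.

Lemma continuous_pos_near (f : R -> R) (t : R) :
  continuous f t -> 0 < f t ->
  exists eps, 0 < eps /\ forall s, Rabs (s - t) < eps -> 0 < f s.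
Proof.
  intros Hc Hp.
  destruct (proj1 (filterlim_locally _ _) Hc (mkposreal _ Hp)) as [d Hd].
  exists d; split; [apply cond_pos|]. intros s Hs.
  specialize (Hd s Hs). change (Rabs (f s - f t) < f t) in Hd.
  apply Rabs_def2 in Hd; lra.
Qed.

Lemma negative_slope_crossing (f : R -> R) (t l : R) :
  is_derive f t l -> l < 0 ->
  exists eps, 0 < eps /\
    forall s, s <> t -> Rabs (s - t) < eps -> (f s - f t) * (s - t) < 0.
Proof.
  intros Hd Hl. apply is_derive_Reals in Hd.
  destruct (Hd (- l) ltac:(lra)) as [d H].
  exists d; split; [apply cond_pos|]. intros s Hs Hst.
  specialize (H (s - t) ltac:(lra) Hst).
  replace (t + (s - t)) with s in H by ring.
  apply Rabs_def2 in H. destruct H as [H _].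
  replace ((f s - f t) * (s - t))
    with ((f s - f t) / (s - t) * (s - t) ^ 2) by (field; lra).
  assert (0 < (s - t) ^ 2) by (apply pow2_gt_0; lra). nra.
Qed.

(** Positivity is assumed just before [t] and not at [t], so that [t] may be the
    time at which an orbit arrives on the axis. *)
Lemma last_zero_before (y : R -> R) (s0 t eps : R) :
  (forall s, continuous y s) -> s0 < t -> y s0 = 0 -> 0 < eps ->
  (forall s, t - eps < s < t -> 0 < y s) ->
  exists t0, t0 < t /\ y t0 = 0 /\ forall s, t0 < s < t -> 0 < y s.
Proof.
  intros Hc Hs0 Hy0 Heps Hpos.
  assert (Hbd : forall s, s < t /\ y s <= 0 -> s <= t - eps).
  { intros s [H1 H2]. apply Rnot_lt_le; intros H3. specialize (Hpos s); lra. }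
  destruct (completeness (fun s => s < t /\ y s <= 0)) as [m [Hub Hlub]].
  - exists (t - eps); intros s Hs; auto.
  - exists s0; lra.
  - assert (Hm : m <= t - eps) by (apply Hlub; intros s Hs; auto).
    assert (Hafter : forall s, m < s < t -> 0 < y s).
    { intros s Hs. apply Rnot_le_lt; intros H.
      pose proof (Hub s (conj (proj2 Hs) H)); lra. }
    exists m; split; [lra|]; split; [|exact Hafter].
    destruct (Rtotal_order (y m) 0) as [H|[H|H]]; auto; exfalso.
    + destruct (continuous_pos_near (fun s => - y s) m) as [d [Hd H']]; try lra.
      { apply (continuous_opp y), Hc. }
      set (s := m + Rmin d eps / 2).
      assert (0 < Rmin d eps) by (apply Rmin_pos; lra).
      pose proof (Rmin_l d eps). pose proof (Rmin_r d eps).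
      specialize (H' s); specialize (Hafter s); unfold s in *.
      rewrite Rabs_pos_eq in H' by lra. lra.
    + destruct (continuous_pos_near y m) as [d [Hd H']]; auto.
      assert (m <= m - d); [|lra].
      apply Hlub. intros s Hs. apply Rnot_lt_le; intros H3.
      specialize (H' s). pose proof (Hub s Hs).
      rewrite Rabs_left1 in H' by lra. lra.
Qed.

Lemma first_zero_after (y : R -> R) (s1 t : R) :
  (forall s, continuous y s) -> t < s1 -> y s1 = 0 -> 0 < y t ->
  exists t1, t < t1 /\ y t1 = 0 /\ forall s, t <= s < t1 -> 0 < y s.
Proof.
  intros Hc Hs1 Hy1 Hyt.
  destruct (continuous_pos_near y t) as [d [Hd H]]; auto.
  destruct (last_zero_before (fun s => y (- s)) (- s1) (- t) d)
    as [t0 [H0 [E Hpos]]]; try lra.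
  - intros s. apply (continuous_comp Ropp y); [|apply Hc].
    apply (is_derive_continuous _ _ (-1)); auto_derive; [exact I | ring].
  - rewrite Ropp_involutive; lra.
  - intros s Hs. apply H. rewrite Rabs_pos_eq; lra.
  - exists (- t0); repeat split; auto; try lra.
    intros s Hs. destruct (Req_dec s t) as [->|]; auto.
    specialize (Hpos (- s)). rewrite Ropp_involutive in Hpos. apply Hpos; lra.
Qed.

(** * Cycles and their arcs in the upper half-plane *)

Definition jointly_continuous (phi : R -> R -> R) : Prop :=
  forall p : R * R, continuous (fun q : R * R => phi (fst q) (snd q)) p.

Lemma continuous_along (phi : R -> R -> R) (x y : R -> R) (t : R) :
  jointly_continuous phi -> continuous x t -> continuous y t ->
  continuous (fun s => phi (x s) (y s)) t.
Proof.
  intros Hphi Hx Hy. apply continuous_comp_2; [exact Hx|exact Hy|].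
  apply (Hphi (x t, y t)).
Qed.

(** A non-constant periodic solution in coordinates; that the orbit avoids the
    origin, the only equilibrium, is the form in which non-constancy is used. *)
Record cycle (phi : R -> R -> R) (T : R) (x y : R -> R) : Prop := {
  cycle_period : 0 < T;
  cycle_dx : forall t, is_derive x t (y t);
  cycle_dy : forall t, is_derive y t (- x t - y t * phi (x t) (y t));
  cycle_x_periodic : forall t, x (t + T) = x t;
  cycle_y_periodic : forall t, y (t + T) = y t;
  cycle_nonzero : forall t, x t = 0 -> y t = 0 -> False
}.

(** The graph of a piece of orbit in the upper half-plane, between two points
    [(a, 0)] and [(b, 0)] of the axis; the derivative is [dy/dx] along the
    field. The extension by 0 outside [[a, b]] lets arcs over different
    intervals be compared at every abscissa. *)
Record upper_arc (phi : R -> R -> R) (f : R -> R) (a b : R) : Prop := {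
  arc_left : a < 0;
  arc_right : 0 < b;
  arc_continuous : forall u, continuous f u;
  arc_pos : forall u, a < u < b -> 0 < f u;
  arc_derive : forall u, a < u < b -> is_derive f u (- u / f u - phi u (f u));
  arc_zero_left : forall u, u <= a -> f u = 0;
  arc_zero_right : forall u, b <= u -> f u = 0
}.

Section Arcs.
Variables (phi : R -> R -> R) (T : R) (x y : R -> R).
Hypothesis Hcyc : cycle phi T x y.

Lemma cycle_x_continuous t : continuous x t.
Proof. apply (is_derive_continuous _ _ _ (cycle_dx _ _ _ _ Hcyc t)). Qed.

Lemma cycle_y_continuous t : continuous y t.
Proof. apply (is_derive_continuous _ _ _ (cycle_dy _ _ _ _ Hcyc t)). Qed.

(** Over one period [x] returns to its value, so its derivative [y] vanishes. *)
Lemma cycle_zero_after t : exists s, t < s /\ y s = 0.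
Proof.
  pose proof (cycle_period _ _ _ _ Hcyc) as HT.
  destruct (mean_value x y t (t + T)) as [c [Hc E]]; try lra.
  - intros s _; apply cycle_x_continuous.
  - intros s _; apply (cycle_dx _ _ _ _ Hcyc).
  - rewrite (cycle_x_periodic _ _ _ _ Hcyc) in E.
    exists c; split; [lra|]. nra.
Qed.

Lemma cycle_zero_before t : exists s, s < t /\ y s = 0.
Proof.
  pose proof (cycle_period _ _ _ _ Hcyc) as HT.
  destruct (mean_value x y (t - T) t) as [c [Hc E]]; try lra.
  - intros s _; apply cycle_x_continuous.
  - intros s _; apply (cycle_dx _ _ _ _ Hcyc).
  - rewrite <- (cycle_x_periodic _ _ _ _ Hcyc (t - T)) in E.
    replace (t - T + T) with t in E by ring.
    exists c; split; [lra|]. nra.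
Qed.

(** On the axis [y' = - x], so an orbit can only go up through it at [x < 0]. *)
Lemma cycle_enters_upper t eps :
  y t = 0 -> 0 < eps -> (forall s, t < s < t + eps -> 0 < y s) -> x t < 0.
Proof.
  intros Hy Heps Hpos.
  destruct (Rtotal_order (x t) 0) as [H|[H|H]]; auto; exfalso.
  - apply (cycle_nonzero _ _ _ _ Hcyc t); auto.
  - destruct (negative_slope_crossing y t _ (cycle_dy _ _ _ _ Hcyc t))
      as [d [Hd H']]; [rewrite Hy; lra|].
    assert (0 < Rmin d eps) by (apply Rmin_pos; lra).
    pose proof (Rmin_l d eps). pose proof (Rmin_r d eps).
    specialize (H' (t + Rmin d eps / 2)). specialize (Hpos (t + Rmin d eps / 2)).
    rewrite Rabs_pos_eq in H' by lra. nra.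
Qed.

Lemma cycle_leaves_upper t eps :
  y t = 0 -> 0 < eps -> (forall s, t - eps < s < t -> 0 < y s) -> 0 < x t.
Proof.
  intros Hy Heps Hpos.
  destruct (Rtotal_order (x t) 0) as [H|[H|H]]; auto; exfalso.
  - destruct (negative_slope_crossing (fun s => - y s) t
                (- (- x t - y t * phi (x t) (y t)))) as [d [Hd H']].
    + apply (is_derive_opp y), (cycle_dy _ _ _ _ Hcyc).
    + rewrite Hy; lra.
    + assert (0 < Rmin d eps) by (apply Rmin_pos; lra).
      pose proof (Rmin_l d eps). pose proof (Rmin_r d eps).
      specialize (H' (t - Rmin d eps / 2)).
      specialize (Hpos (t - Rmin d eps / 2)).
      rewrite Rabs_left1 in H' by lra. nra.
  - apply (cycle_nonzero _ _ _ _ Hcyc t); auto.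
Qed.

Lemma cycle_positive_before t :
  0 < y t \/ (y t = 0 /\ 0 < x t) ->
  exists eps, 0 < eps /\ forall s, t - eps < s < t -> 0 < y s.
Proof.
  intros [H|[H1 H2]].
  - destruct (continuous_pos_near y t (cycle_y_continuous t) H) as [d [Hd H']].
    exists d; split; auto. intros s Hs; apply H'. rewrite Rabs_left1; lra.
  - destruct (negative_slope_crossing y t _ (cycle_dy _ _ _ _ Hcyc t))
      as [d [Hd H']]; [rewrite H1; lra|].
    exists d; split; auto. intros s Hs. specialize (H' s).
    rewrite Rabs_left1 in H' by lra. nra.
Qed.

(** Between two consecutive zeros of [y] where [y > 0], the abscissa increases
    strictly, so the orbit is a graph over it. The case [y t = 0] and
    [0 < x t] is that of the right end of the arc. *)
Lemma upper_arc_through t :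
  0 < y t \/ (y t = 0 /\ 0 < x t) ->
  exists f a b, upper_arc phi f a b /\ a < x t <= b /\ f (x t) = y t /\
    forall u, a <= u <= b -> exists s, x s = u /\ y s = f u.
Proof.
  intros Ht.
  assert (Hbefore : exists t0, t0 < t /\ y t0 = 0 /\
            forall s, t0 < s < t -> 0 < y s).
  { destruct (cycle_positive_before t Ht) as [eps [Heps Hpos]].
    destruct (cycle_zero_before t) as [s0 [Hs0 Hy0]].
    apply (last_zero_before y s0 t eps); auto using cycle_y_continuous. }
  assert (Hafter : exists t1, t <= t1 /\ y t1 = 0 /\
            forall s, t <= s < t1 -> 0 < y s).
  { destruct Ht as [H|[H _]].
    - destruct (cycle_zero_after t) as [s1 [Hs1 Hy1]].
      destruct (first_zero_after y s1 t) as [t1 [H1 H2]];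
        auto using cycle_y_continuous.
      exists t1; split; [lra|auto].
    - exists t; repeat split; auto; [lra|]. intros s Hs; lra. }
  destruct Hbefore as [t0 [Ht0 [Hy0 Hpos0]]].
  destruct Hafter as [t1 [Ht1 [Hy1 Hpos1]]].
  assert (Hpos : forall s, t0 < s < t1 -> 0 < y s).
  { intros s Hs; destruct (Rlt_or_le s t); [apply Hpos0|apply Hpos1]; lra. }
  assert (H01 : t0 < t1) by lra.
  destruct (increasing_inverse x y t0 t1) as
    [tau [Hr [Hback [Hinv [Hlow [Hhigh [Hcont Hder]]]]]]]; auto.
  { apply (cycle_dx _ _ _ _ Hcyc). }
  assert (Ha : x t0 < 0).
  { apply (cycle_enters_upper t0 (t1 - t0)); auto; [lra|].
    intros s Hs; apply Hpos; lra. }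
  assert (Hb : 0 < x t1).
  { apply (cycle_leaves_upper t1 (t1 - t0)); auto; [lra|].
    intros s Hs; apply Hpos; lra. }
  assert (Hin : forall u, x t0 < u < x t1 -> t0 < tau u < t1).
  { intros u Hu. pose proof (Hinv u ltac:(lra)) as E. pose proof (Hr u).
    assert (tau u <> t0) by (intros E'; rewrite E' in E; lra).
    assert (tau u <> t1) by (intros E'; rewrite E' in E; lra). lra. }
  exists (fun u => y (tau u)), (x t0), (x t1). split; [|split; [|split]].
  - split; auto.
    + intros u. apply (continuous_comp tau y); auto using cycle_y_continuous.
    + intros u Hu.
      pose proof (Hpos _ (Hin u Hu)) as Hp.
      replace (- u / y (tau u) - phi u (y (tau u)))
        with (scal (/ y (tau u))
               (- x (tau u) - y (tau u) * phi (x (tau u)) (y (tau u)))).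
      * apply (is_derive_comp y tau); auto. apply (cycle_dy _ _ _ _ Hcyc).
      * rewrite Hinv by lra. unfold scal; simpl; unfold mult; simpl.
        field; lra.
    + intros u Hu; rewrite Hlow; auto.
    + intros u Hu; rewrite Hhigh; auto.
  - assert (Hmono : forall s s', t0 <= s -> s < s' -> s' <= t1 -> x s < x s').
    { intros s s' H1 H2 H3.
      destruct (mean_value x y s s' H2) as [c [Hc E]].
      - intros r _; apply cycle_x_continuous.
      - intros r _; apply (cycle_dx _ _ _ _ Hcyc).
      - assert (0 < y c) by (apply Hpos; lra). nra. }
    split; [apply Hmono; lra|].
    destruct (Req_dec t t1) as [->|]; [lra|]. apply Rlt_le, Hmono; lra.
  - rewrite Hback; auto; lra.
  - intros u Hu. exists (tau u); split; auto.
Qed.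

End Arcs.

(** Seen from the origin, which is below the arc as [f 0 > 0], the ray reaches a
    point above the arc, so it crosses it earlier. Since [f] is 0 outside
    [[a, b]], a crossing at positive height is automatically on the arc. *)
Lemma ray_meets_arc phi f a b (u v m0 : R) :
  upper_arc phi f a b -> 0 < v -> 0 < m0 -> f (m0 * u) < m0 * v ->
  exists m, 0 < m < m0 /\ a < m * u < b /\ f (m * u) = m * v.
Proof.
  intros Hf Hv Hm0 H.
  destruct (intermediate_zero (fun m => m * v - f (m * u)) 0 m0) as [m [Hm E]].
  - exact Hm0.
  - intros m _. apply (continuous_minus (fun m => m * v) (fun m => f (m * u))).
    + apply (is_derive_continuous _ _ v). auto_derive; auto; ring.
    + apply (continuous_comp (fun m => m * u) f).
      * apply (is_derive_continuous _ _ u). auto_derive; auto; ring.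
      * apply (arc_continuous _ _ _ _ Hf).
  - pose proof (arc_left _ _ _ _ Hf); pose proof (arc_right _ _ _ _ Hf).
    pose proof (arc_pos _ _ _ _ Hf 0). rewrite !Rmult_0_l. nra.
  - exists m; split; [exact Hm|]. split; [|lra].
    assert (0 < m * v) by nra.
    split; apply Rnot_le_lt; intros Hle.
    + rewrite (arc_zero_left _ _ _ _ Hf) in E; lra.
    + rewrite (arc_zero_right _ _ _ _ Hf) in E; lra.
Qed.

(** * Comparison of an upper arc with a dilated upper arc *)

Definition radially_increasing (phi : R -> R -> R) : Prop :=
  forall x y k, x <> 0 \/ y <> 0 -> 1 < k -> phi x y < phi (k * x) (k * y).

Lemma arc_nonneg phi f a b u : upper_arc phi f a b -> 0 <= f u.
Proof.
  intros Hf.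
  destruct (Rle_or_lt u a); [rewrite (arc_zero_left _ _ _ _ Hf); lra|].
  destruct (Rle_or_lt b u); [rewrite (arc_zero_right _ _ _ _ Hf); lra|].
  apply Rlt_le, (arc_pos _ _ _ _ Hf); lra.
Qed.

(** The gap is measured at [u] on the first arc and at [K * u] on the second,
    so that no division by [K] occurs. *)
Lemma is_derive_arc_gap phi f1 a1 b1 f2 a2 b2 K u :
  upper_arc phi f1 a1 b1 -> upper_arc phi f2 a2 b2 ->
  a1 < u < b1 -> a2 < K * u < b2 ->
  is_derive (fun w => K * f1 w - f2 (K * w)) u
    (K * (K * u / f2 (K * u) - u / f1 u
          + (phi (K * u) (f2 (K * u)) - phi u (f1 u)))).
Proof.
  intros H1 H2 Hu1 Hu2.
  pose proof (arc_pos _ _ _ _ H1 u Hu1). pose proof (arc_pos _ _ _ _ H2 _ Hu2).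
  pose proof (arc_derive _ _ _ _ H1 u Hu1) as D1.
  pose proof (arc_derive _ _ _ _ H2 _ Hu2) as D2.
  evar_last.
  - apply (is_derive_minus (fun w => K * f1 w) (fun w => f2 (K * w))).
    + apply (is_derive_scal f1), D1.
    + apply (is_derive_comp f2 (fun w => K * w)); [exact D2|].
      apply is_derive_linear.
  - unfold minus, plus, opp, scal; simpl; unfold mult; simpl. field; lra.
Qed.

(** At a touching point the terms [x / y] of the two slopes agree, because they
    are invariant under dilation. The gap between the arcs therefore has the
    positive derivative [K * (phi (K p) - phi p)] at a point where it is
    minimal. *)
Lemma arcs_touch_inside phi f1 a1 b1 f2 a2 b2 K u :
  radially_increasing phi ->
  upper_arc phi f1 a1 b1 -> upper_arc phi f2 a2 b2 -> 1 < K ->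
  (forall w, f2 (K * w) <= K * f1 w) ->
  0 < f1 u -> f2 (K * u) = K * f1 u -> False.
Proof.
  intros Hphi H1 H2 HK Hle Hpos E.
  assert (Hu1 : a1 < u < b1).
  { split; apply Rnot_le_lt; intros H.
    - rewrite (arc_zero_left _ _ _ _ H1) in Hpos; lra.
    - rewrite (arc_zero_right _ _ _ _ H1) in Hpos; lra. }
  assert (Hpos2 : 0 < f2 (K * u)) by nra.
  assert (Hu2 : a2 < K * u < b2).
  { split; apply Rnot_le_lt; intros H.
    - rewrite (arc_zero_left _ _ _ _ H2) in Hpos2; lra.
    - rewrite (arc_zero_right _ _ _ _ H2) in Hpos2; lra. }
  pose proof (is_derive_arc_gap _ _ _ _ _ _ _ K u H1 H2 Hu1 Hu2) as D.
  rewrite E in D.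
  replace (K * u / (K * f1 u) - u / f1 u) with 0 in D by (field; lra).
  pose proof (Hphi u (f1 u) K ltac:(right; lra) HK) as Hlt.
  set (l := phi (K * u) (K * f1 u) - phi u (f1 u)) in *.
  destruct (negative_slope_crossing (fun w => - (K * f1 w - f2 (K * w))) u
              (- (K * (0 + l)))) as [d [Hd H]].
  - apply (is_derive_opp (fun w => K * f1 w - f2 (K * w))), D.
  - unfold l; nra.
  - specialize (H (u - d / 2) ltac:(lra)).
    rewrite Rabs_left1 in H by lra. specialize (H ltac:(lra)).
    specialize (Hle (u - d / 2)). rewrite E in H. nra.
Qed.

(** Here both slopes tend to minus infinity. Just before the common right end,
    [0 < u] and [f2 (K * u) <= K * f1 u] make the difference of the terms
    [x / y] nonnegative, and the difference of the values of [phi] is close to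
    [phi (b2, 0) - phi (b1, 0) > 0]. So the gap increases to 0, and was
    negative before. At a common left end the sign of [u] would spoil this
    argument. *)
Lemma arcs_touch_right_end phi f1 a1 b1 f2 a2 b2 K :
  jointly_continuous phi -> radially_increasing phi ->
  upper_arc phi f1 a1 b1 -> upper_arc phi f2 a2 b2 -> 1 < K ->
  (forall w, f2 (K * w) <= K * f1 w) ->
  b2 = K * b1 -> False.
Proof.
  intros Hcont Hphi H1 H2 HK Hle E.
  pose proof (arc_right _ _ _ _ H1) as Hb1.
  pose proof (arc_left _ _ _ _ H1). pose proof (arc_left _ _ _ _ H2).
  assert (Hscale : forall u, continuous (fun w => K * w) u).
  { intros u. apply (is_derive_continuous _ _ K), is_derive_linear. }
  assert (Hc1 : forall u, continuous f1 u) by apply (arc_continuous _ _ _ _ H1).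
  assert (Hc2 : forall u, continuous (fun w => f2 (K * w)) u).
  { intros u. apply (continuous_comp (fun w => K * w) f2); auto.
    apply (arc_continuous _ _ _ _ H2). }
  destruct (continuous_pos_near
    (fun w => phi (K * w) (f2 (K * w)) - phi w (f1 w)) b1) as [d [Hd Hgap]].
  - apply (continuous_minus (fun w => phi (K * w) (f2 (K * w)))
             (fun w => phi w (f1 w))).
    + apply (continuous_along phi (fun w => K * w) (fun w => f2 (K * w))); auto.
    + apply (continuous_along phi (fun w => w) f1); auto using continuous_id.
  - rewrite (arc_zero_right _ _ _ _ H1) by lra.
    rewrite (arc_zero_right _ _ _ _ H2) by lra.
    pose proof (Hphi b1 0 K ltac:(left; lra) HK) as H'.
    rewrite Rmult_0_r in H'. lra.
  - set (u := b1 - Rmin d b1 / 2).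
    assert (0 < Rmin d b1) by (apply Rmin_pos; lra).
    pose proof (Rmin_l d b1). pose proof (Rmin_r d b1).
    assert (Hu : 0 < u < b1) by (unfold u; lra).
    destruct (mean_value (fun w => K * f1 w - f2 (K * w))
      (fun w => K * (K * w / f2 (K * w) - w / f1 w
                     + (phi (K * w) (f2 (K * w)) - phi w (f1 w)))) u b1)
      as [c [Hc Ec]].
    + lra.
    + intros w _. apply (continuous_minus (fun w => K * f1 w)); auto.
      apply (continuous_scal_r K f1), Hc1.
    + intros w Hw. apply (is_derive_arc_gap _ _ a1 b1 _ a2 b2); auto; nra.
    + rewrite (arc_zero_right _ _ _ _ H1 b1) in Ec by lra.
      rewrite (arc_zero_right _ _ _ _ H2 (K * b1)) in Ec by lra.
      assert (Hp1 : 0 < f1 c) by (apply (arc_pos _ _ _ _ H1); lra).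
      assert (Hp2 : 0 < f2 (K * c)) by (apply (arc_pos _ _ _ _ H2); nra).
      assert (Hfrac : c / f1 c <= K * c / f2 (K * c)).
      { replace (c / f1 c) with (K * c / (K * f1 c)) by (field; lra).
        apply Rmult_le_compat_l; [nra|]. apply Rinv_le_contravar; auto. }
      specialize (Hgap c). rewrite Rabs_left1 in Hgap by (unfold u in *; lra).
      specialize (Hgap ltac:(unfold u in *; lra)).
      specialize (Hle u).
      set (g := K * c / f2 (K * c) - c / f1 c +
            (phi (K * c) (f2 (K * c)) - phi c (f1 c))) in *.
      assert (0 < g) by (unfold g; lra).
      assert (0 < K * g * (b1 - u)) by (repeat apply Rmult_lt_0_compat; lra).
      lra.
Qed.

Definition on_ray (x1 y1 x2 y2 : R -> R) (k s t : R) : Prop :=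
  x2 t = k * x1 s /\ y2 t = k * y1 s.

Definition ray_ratio_le (x1 y1 x2 y2 : R -> R) (K : R) : Prop :=
  forall k s t, 0 < k -> on_ray x1 y1 x2 y2 k s t -> k <= K.

(** Maximality of [K] puts the arc of the second cycle under the dilated arc of
    the first: above it, the segment to the origin would meet the dilated arc,
    at a point with a ratio larger than [K]. *)
Lemma no_extremal_upper_touch phi T1 T2 x1 y1 x2 y2 K s t :
  jointly_continuous phi -> radially_increasing phi ->
  cycle phi T1 x1 y1 -> cycle phi T2 x2 y2 -> 1 < K ->
  ray_ratio_le x1 y1 x2 y2 K ->
  on_ray x1 y1 x2 y2 K s t ->
  0 < y1 s \/ (y1 s = 0 /\ 0 < x1 s) -> False.
Proof.
  intros Hcont Hphi Hc1 Hc2 HK Hmax [Ex Ey] Hs.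
  assert (Ht : 0 < y2 t \/ (y2 t = 0 /\ 0 < x2 t)).
  { rewrite Ex, Ey. destruct Hs as [H|[H H']]; [left; nra|].
    right; rewrite H; split; nra. }
  destruct (upper_arc_through _ _ _ _ Hc1 s Hs)
    as [f1 [a1 [b1 [H1 [Hr1 [E1 Hon1]]]]]].
  destruct (upper_arc_through _ _ _ _ Hc2 t Ht)
    as [f2 [a2 [b2 [H2 [Hr2 [E2 Hon2]]]]]].
  assert (Hle : forall w, f2 (K * w) <= K * f1 w).
  { intros w. apply Rnot_lt_le; intros Hlt.
    pose proof (arc_nonneg _ _ _ _ w H1) as Hn.
    assert (Hpos : 0 < f2 (K * w)) by nra.
    destruct (ray_meets_arc _ _ _ _ w (f2 (K * w) / K) 1 H1)
      as [m [Hm [Hin Em]]].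
    - apply Rdiv_lt_0_compat; lra.
    - lra.
    - rewrite !Rmult_1_l. apply (Rmult_lt_reg_l K); [lra|].
      replace (K * (f2 (K * w) / K)) with (f2 (K * w)) by (field; lra). lra.
    - destruct (Hon1 (m * w)) as [s' [Exs Eys]]; [lra|].
      destruct (Hon2 (K * w)) as [t' [Ext Eyt]].
      { split; apply Rnot_lt_le; intros H.
        - rewrite (arc_zero_left _ _ _ _ H2) in Hpos; lra.
        - rewrite (arc_zero_right _ _ _ _ H2) in Hpos; lra. }
      (* The point [m * (w, f2 (K * w) / K)] is on the first cycle, so the
         point [(K * w, f2 (K * w))] of the second has ratio [K / m > K]. *)
      assert (HKm : K / m <= K).
      { apply (Hmax (K / m) s' t').
        - apply Rdiv_lt_0_compat; lra.
        - split; [rewrite Ext, Exs|rewrite Eyt, Eys, Em]; field; lra. }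
      assert (K < K / m); [|lra].
      apply (Rmult_lt_reg_r m); [lra|]. unfold Rdiv.
      rewrite Rmult_assoc, Rinv_l by lra. nra. }
  destruct Hs as [Hs|[Hs Hs']].
  - apply (arcs_touch_inside _ _ _ _ _ _ _ K (x1 s) Hphi H1 H2); auto.
    + rewrite E1; auto.
    + rewrite <- Ex, E1, E2, <- Ey; auto.
  - assert (Hb1 : x1 s = b1).
    { destruct (Req_dec (x1 s) b1) as [|Hne]; auto.
      pose proof (arc_pos _ _ _ _ H1 (x1 s)). lra. }
    assert (Hb2 : x2 t = b2).
    { destruct (Req_dec (x2 t) b2) as [|Hne]; auto.
      pose proof (arc_pos _ _ _ _ H2 (x2 t)).
      rewrite Hs, Rmult_0_r in Ey. lra. }
    apply (arcs_touch_right_end _ _ _ _ _ _ _ K Hcont Hphi H1 H2); auto.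
    now rewrite <- Hb1, <- Hb2.
Qed.

Lemma cycle_central_symmetry phi T x y :
  cycle phi T x y ->
  cycle (fun u v => phi (- u) (- v)) T (fun t => - x t) (fun t => - y t).
Proof.
  intros H; split.
  - apply (cycle_period _ _ _ _ H).
  - intros t. apply (is_derive_opp x), (cycle_dx _ _ _ _ H).
  - intros t. rewrite !Ropp_involutive.
    evar_last; [apply (is_derive_opp y), (cycle_dy _ _ _ _ H)|].
    unfold opp; simpl; ring.
  - intros t; rewrite (cycle_x_periodic _ _ _ _ H); auto.
  - intros t; rewrite (cycle_y_periodic _ _ _ _ H); auto.
  - intros t Hx Hy; apply (cycle_nonzero _ _ _ _ H t); lra.
Qed.

(** Reversing time and reflecting in the [x]-axis keeps [x' = y] and changes the
    sign of the friction. *)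
Lemma cycle_time_reversal phi T x y :
  cycle phi T x y ->
  cycle (fun u v => - phi u (- v)) T (fun t => x (- t)) (fun t => - y (- t)).
Proof.
  intros H.
  assert (Hopp : forall t, is_derive (fun t => - t) t (-1)).
  { intros t; auto_derive; [exact I | ring]. }
  split.
  - apply (cycle_period _ _ _ _ H).
  - intros t. evar_last.
    + apply (is_derive_comp x (fun t => - t)); [apply (cycle_dx _ _ _ _ H)|apply Hopp].
    + unfold scal; simpl; unfold mult; simpl; ring.
  - intros t. rewrite Ropp_involutive. evar_last.
    + apply (is_derive_opp (fun t => y (- t))).
      apply (is_derive_comp y (fun t => - t)); [apply (cycle_dy _ _ _ _ H)|apply Hopp].
    + unfold scal, opp; simpl; unfold mult; simpl; ring.
  - intros t. rewrite <- (cycle_x_periodic _ _ _ _ H (- (t + T))).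
    f_equal; ring.
  - intros t. rewrite <- (cycle_y_periodic _ _ _ _ H (- (t + T))).
    do 2 f_equal; ring.
  - intros t Hx Hy; apply (cycle_nonzero _ _ _ _ H (- t)); lra.
Qed.

(** A lower point, or a left end, becomes an upper point, or a right end, under
    the central symmetry, which preserves radial monotonicity and ratios. *)
Lemma no_extremal_touch phi T1 T2 x1 y1 x2 y2 K s t :
  jointly_continuous phi -> radially_increasing phi ->
  cycle phi T1 x1 y1 -> cycle phi T2 x2 y2 -> 1 < K ->
  ray_ratio_le x1 y1 x2 y2 K ->
  on_ray x1 y1 x2 y2 K s t -> False.
Proof.
  intros Hcont Hphi Hc1 Hc2 HK Hmax Hray.
  assert (Hcase : (0 < y1 s \/ (y1 s = 0 /\ 0 < x1 s)) \/
                  (0 < - y1 s \/ (- y1 s = 0 /\ 0 < - x1 s))).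
  { pose proof (cycle_nonzero _ _ _ _ Hc1 s). lra. }
  destruct Hcase as [Hs|Hs].
  - apply (no_extremal_upper_touch phi T1 T2 x1 y1 x2 y2 K s t); auto.
  - apply (no_extremal_upper_touch (fun u v => phi (- u) (- v)) T1 T2
             (fun t => - x1 t) (fun t => - y1 t)
             (fun t => - x2 t) (fun t => - y2 t) K s t);
      auto using cycle_central_symmetry.
    + intros p.
      apply (continuous_comp_2 (fun q : R * R => - fst q) (fun q => - snd q) phi).
      * apply (continuous_opp (fun q : R * R => fst q)), continuous_fst.
      * apply (continuous_opp (fun q : R * R => snd q)), continuous_snd.
      * apply Hcont.
    + intros u v k Huv Hk.
      replace (- (k * u)) with (k * - u) by ring.
      replace (- (k * v)) with (k * - v) by ring.
      apply Hphi; auto. destruct Huv; [left|right]; lra.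
    + intros k s' t' Hk [Ex Ey]. apply (Hmax k s' t'); [|split]; lra.
    + destruct Hray; split; lra.
Qed.

(** * The largest dilation ratio between two cycles *)

Lemma periodic_shift (T : R) (g : R -> R * R) :
  (forall t, g (t + T) = g t) -> forall (z : Z) t, g (t + IZR z * T) = g t.
Proof.
  intros Hg.
  assert (Hnat : forall (n : nat) t, g (t + INR n * T) = g t).
  { induction n as [|n IH]; intros t.
    - f_equal; simpl; ring.
    - rewrite S_INR, <- (IH t), <- (Hg (t + INR n * T)). f_equal; ring. }
  intros z t.
  destruct (Z_le_gt_dec 0 z) as [Hz|Hz].
  - rewrite <- (Z2Nat.id z Hz), <- INR_IZR_INZ. apply Hnat.
  - rewrite <- (Hnat (Z.to_nat (- z)) (t + IZR z * T)).
    rewrite INR_IZR_INZ, Z2Nat.id, opp_IZR by lia. f_equal; ring.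
Qed.

Lemma periodic_representative (T : R) (g : R -> R * R) :
  0 < T -> (forall t, g (t + T) = g t) ->
  forall t, exists s, 0 <= s <= T /\ g s = g t.
Proof.
  intros HT Hg t. destruct (archimed (- t / T)) as [H1 H2].
  exists (t + IZR (up (- t / T)) * T). split.
  - assert (E : - t / T * T = - t) by (field; lra).
    split.
    + apply (Rmult_gt_compat_r T) in H1; lra.
    + apply (Rmult_le_compat_r T) in H2; lra.
  - now apply periodic_shift.
Qed.

Lemma cycle_representative phi T x y :
  cycle phi T x y -> forall t, exists s, 0 <= s <= T /\ x s = x t /\ y s = y t.
Proof.
  intros H t.
  destruct (periodic_representative T (fun t => (x t, y t))
              (cycle_period _ _ _ _ H)) with (t := t) as [s [Hs E]].
  - intros r. now rewrite (cycle_x_periodic _ _ _ _ H),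
      (cycle_y_periodic _ _ _ _ H).
  - exists s; split; auto. now inversion E.
Qed.

Lemma continuous_norm2 (x y : R -> R) t :
  continuous x t -> continuous y t -> continuous (fun s => x s * x s + y s * y s) t.
Proof.
  intros Hx Hy.
  apply (continuous_plus (fun s => x s * x s) (fun s => y s * y s)).
  - now apply (continuous_mult x x).
  - now apply (continuous_mult y y).
Qed.

Lemma ray_ratio_bounded phi T1 T2 x1 y1 x2 y2 :
  cycle phi T1 x1 y1 -> cycle phi T2 x2 y2 ->
  exists B, ray_ratio_le x1 y1 x2 y2 B.
Proof.
  intros H1 H2.
  pose proof (cycle_period _ _ _ _ H1). pose proof (cycle_period _ _ _ _ H2).
  destruct (continuity_ab_min (fun s => x1 s * x1 s + y1 s * y1 s) 0 T1)
    as [sm [Hmin _]]; [lra| |].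
  { intros c _. apply continuity_pt_filterlim, continuous_norm2;
      [apply (cycle_x_continuous _ _ _ _ H1)|apply (cycle_y_continuous _ _ _ _ H1)]. }
  destruct (continuity_ab_maj (fun s => x2 s * x2 s + y2 s * y2 s) 0 T2)
    as [tm [Hmax _]]; [lra| |].
  { intros c _. apply continuity_pt_filterlim, continuous_norm2;
      [apply (cycle_x_continuous _ _ _ _ H2)|apply (cycle_y_continuous _ _ _ _ H2)]. }
  cbv beta in *.
  set (m := x1 sm * x1 sm + y1 sm * y1 sm) in *.
  set (M := x2 tm * x2 tm + y2 tm * y2 tm) in *.
  assert (Hm : 0 < m).
  { unfold m. destruct (Req_dec (x1 sm) 0) as [E|]; [|nra].
    destruct (Req_dec (y1 sm) 0) as [E'|]; [|nra].
    exfalso; exact (cycle_nonzero _ _ _ _ H1 sm E E'). }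
  (* A ratio [k > 1] satisfies [k * m <= k ^ 2 * m <= M]. *)
  exists (Rmax 1 (M / m)). intros k s t Hk [Ex Ey].
  destruct (Rle_or_lt k 1) as [Hk1|Hk1];
    [eapply Rle_trans; [exact Hk1|apply Rmax_l]|].
  eapply Rle_trans; [|apply Rmax_r].
  destruct (cycle_representative _ _ _ _ H1 s) as [s' [Hs' [E1 E2]]].
  destruct (cycle_representative _ _ _ _ H2 t) as [t' [Ht' [E3 E4]]].
  specialize (Hmin s' Hs'). specialize (Hmax t' Ht').
  rewrite E1, E2 in Hmin. rewrite E3, E4, Ex, Ey in Hmax.
  apply (Rmult_le_reg_r m); [lra|]. unfold Rdiv.
  rewrite Rmult_assoc, Rinv_l by lra.
  set (n := x1 s * x1 s + y1 s * y1 s) in *.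
  replace (k * x1 s * (k * x1 s) + k * y1 s * (k * y1 s))
    with (k * (k * n)) in Hmax by (unfold n; ring).
  assert (k * m <= k * n) by nra. assert (0 < k * n) by nra.
  assert (0 <= (k - 1) * (k * n)) by nra. lra.
Qed.

Lemma mismatch_open (g1 g2 : R -> R) (K s t : R) :
  continuous g1 s -> continuous g2 t -> g2 t <> K * g1 s ->
  exists d : posreal, forall k s' t',
    Rabs (k - K) < d -> Rabs (s' - s) < d -> Rabs (t' - t) < d ->
    g2 t' <> k * g1 s'.
Proof.
  intros H1 H2 Hne.
  set (F := fun p : R * (R * R) => g2 (snd (snd p)) - fst p * g1 (fst (snd p))).
  assert (HF : continuous F (K, (s, t))).
  { apply (continuous_minus (fun p : R * (R * R) => g2 (snd (snd p)))
             (fun p : R * (R * R) => fst p * g1 (fst (snd p)))).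
    - apply (continuous_comp (fun p : R * (R * R) => snd (snd p)) g2); auto.
      apply (continuous_comp (fun p : R * (R * R) => snd p) snd);
        apply continuous_snd.
    - apply (continuous_mult (fun p : R * (R * R) => fst p)
               (fun p : R * (R * R) => g1 (fst (snd p)))).
      + apply continuous_fst.
      + apply (continuous_comp (fun p : R * (R * R) => fst (snd p)) g1); auto.
        apply (continuous_comp (fun p : R * (R * R) => snd p) fst);
          [apply continuous_snd|apply continuous_fst]. }
  assert (Hpos : 0 < Rabs (F (K, (s, t)))).
  { apply Rabs_pos_lt. unfold F; simpl. lra. }
  destruct (proj1 (filterlim_locally _ _) HF (mkposreal _ Hpos)) as [d Hd].
  exists d. intros k s' t' Hk Hs Ht E.
  specialize (Hd (k, (s', t')) (conj Hk (conj Hs Ht))).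
  change (Rabs (F (k, (s', t')) - F (K, (s, t))) < Rabs (F (K, (s, t)))) in Hd.
  replace (F (k, (s', t'))) with 0 in Hd by (unfold F; simpl; lra).
  rewrite Rminus_0_l, Rabs_Ropp in Hd. lra.
Qed.

(** If the supremum were not attained, each pair of times would have a
    neighbourhood in which no ratio near [K] occurs; by compactness of the
    square of one period each, ratios would stay away from [K]. *)
Lemma ray_ratio_sup_attained phi T1 T2 x1 y1 x2 y2 K :
  cycle phi T1 x1 y1 -> cycle phi T2 x2 y2 ->
  is_lub (fun k => 0 < k /\ exists s t, on_ray x1 y1 x2 y2 k s t) K ->
  exists s t, on_ray x1 y1 x2 y2 K s t.
Proof.
  intros H1 H2 [Hub Hlub].
  apply NNPP; intros Hno.
  assert (Hd : forall p : R * R, exists d : posreal, forall k s t,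
    Rabs (k - K) < d -> Rabs (s - fst p) < d -> Rabs (t - snd p) < d ->
    ~ on_ray x1 y1 x2 y2 k s t).
  { intros [s t]; simpl.
    destruct (Req_dec (x2 t) (K * x1 s)) as [Ex|Ex].
    - destruct (Req_dec (y2 t) (K * y1 s)) as [Ey|Ey].
      + exfalso; apply Hno; exists s, t; split; auto.
      + destruct (mismatch_open y1 y2 K s t) as [d Hd]; auto;
          [apply (cycle_y_continuous _ _ _ _ H1)|
           apply (cycle_y_continuous _ _ _ _ H2)|].
        exists d; intros k s' t' A B C [_ E]. exact (Hd k s' t' A B C E).
    - destruct (mismatch_open x1 x2 K s t) as [d Hd]; auto;
        [apply (cycle_x_continuous _ _ _ _ H1)|
         apply (cycle_x_continuous _ _ _ _ H2)|].
      exists d; intros k s' t' A B C [E _]. exact (Hd k s' t' A B C E). }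
  set (delta := fun s t =>
    proj1_sig (constructive_indefinite_description _ (Hd (s, t)))).
  destruct (compactness_value_2d 0 T1 0 T2 delta) as [d Hcomp].
  assert (K <= K - d).
  { apply Hlub. intros k [Hk [s [t [Ex Ey]]]].
    apply Rnot_lt_le; intros Hlt.
    destruct (cycle_representative _ _ _ _ H1 s) as [s' [Hs' [E1 E2]]].
    destruct (cycle_representative _ _ _ _ H2 t) as [t' [Ht' [E3 E4]]].
    assert (HkK : k <= K).
    { apply Hub; split; auto. exists s, t; split; auto. }
    apply (Hcomp s' t' Hs' Ht'). intros [u [v [_ [_ [Hu [Hv Hle]]]]]].
    unfold delta in Hu, Hv, Hle.
    destruct (constructive_indefinite_description _ (Hd (u, v))) as [e He].
    simpl in *. apply (He k s' t'); auto.
    - rewrite Rabs_left1; lra.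
    - split; congruence. }
  pose proof (cond_pos d). lra.
Qed.

Lemma ray_ratio_le_one_increasing phi T1 T2 x1 y1 x2 y2 :
  jointly_continuous phi -> radially_increasing phi ->
  cycle phi T1 x1 y1 -> cycle phi T2 x2 y2 ->
  ray_ratio_le x1 y1 x2 y2 1.
Proof.
  intros Hcont Hphi H1 H2 k s t Hk Hray.
  apply Rnot_lt_le; intros Hk1.
  destruct (completeness
    (fun k => 0 < k /\ exists s t, on_ray x1 y1 x2 y2 k s t)) as [K HK].
  - destruct (ray_ratio_bounded _ _ _ _ _ _ _ H1 H2) as [B HB].
    exists B. intros k' [Hk' [s' [t' Hray']]]. exact (HB k' s' t' Hk' Hray').
  - exists k; split; auto. exists s, t; exact Hray.
  - assert (HkK : k <= K).
    { apply HK; split; auto. exists s, t; exact Hray. }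
    destruct (ray_ratio_sup_attained _ _ _ _ _ _ _ K H1 H2 HK)
      as [s' [t' Hray']].
    apply (no_extremal_touch phi T1 T2 x1 y1 x2 y2 K s' t'); auto; [lra|].
    intros k' s'' t'' Hk' Hray''. apply HK; split; auto.
    exists s'', t''; exact Hray''.
Qed.

Lemma ray_ratio_le_one phi T1 T2 x1 y1 x2 y2 :
  jointly_continuous phi ->
  radially_increasing phi \/ radially_increasing (fun u v => - phi u v) ->
  cycle phi T1 x1 y1 -> cycle phi T2 x2 y2 ->
  ray_ratio_le x1 y1 x2 y2 1.
Proof.
  intros Hcont [Hphi|Hphi] H1 H2.
  - apply (ray_ratio_le_one_increasing phi T1 T2); auto.
  - intros k s t Hk [Ex Ey].
    apply (ray_ratio_le_one_increasing (fun u v => - phi u (- v)) T1 T2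
      (fun t => x1 (- t)) (fun t => - y1 (- t))
      (fun t => x2 (- t)) (fun t => - y2 (- t))) with (s := - s) (t := - t);
      auto using cycle_time_reversal.
    + intros p.
      apply (continuous_opp (fun q : R * R => phi (fst q) (- snd q))).
      apply (continuous_comp_2 (fun q : R * R => fst q) (fun q => - snd q) phi).
      * apply continuous_fst.
      * apply (continuous_opp (fun q : R * R => snd q)), continuous_snd.
      * apply Hcont.
    + intros u v r Huv Hr.
      replace (- (r * v)) with (r * - v) by ring.
      apply Hphi; auto. destruct Huv; [left|right]; lra.
    + split; rewrite !Ropp_involutive; [exact Ex|rewrite Ey; ring].
Qed.

(** * Every ray meets every cycle *)

Lemma cycle_has_upper_arc phi T x y :
  cycle phi T x y ->
  exists f a b, upper_arc phi f a b /\
    forall u, a <= u <= b -> exists s, x s = u /\ y s = f u.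
Proof.
  intros H.
  assert (Ht : exists t, 0 < y t \/ (y t = 0 /\ 0 < x t)).
  { destruct (cycle_zero_after _ _ _ _ H 0) as [t [_ Hy]].
    destruct (Rtotal_order (x t) 0) as [Hx|[Hx|Hx]].
    - destruct (negative_slope_crossing (fun s => - y s) t
                  (- (- x t - y t * phi (x t) (y t)))) as [d [Hd Hs]].
      + apply (is_derive_opp y), (cycle_dy _ _ _ _ H).
      + rewrite Hy; lra.
      + exists (t + d / 2); left. specialize (Hs (t + d / 2) ltac:(lra)).
        rewrite Rabs_pos_eq in Hs by lra. specialize (Hs ltac:(lra)).
        rewrite Hy in Hs. nra.
    - exfalso; exact (cycle_nonzero _ _ _ _ H t Hx Hy).
    - exists t; right; auto. }
  destruct Ht as [t Ht].
  destruct (upper_arc_through _ _ _ _ H t Ht) as [f [a [b [Hf [_ [_ Hon]]]]]].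
  exists f, a, b; auto.
Qed.

Lemma cycle_meets_upper_ray phi T x y u v :
  cycle phi T x y -> 0 < v \/ (v = 0 /\ u <> 0) ->
  exists k s, 0 < k /\ u = k * x s /\ v = k * y s.
Proof.
  intros H Huv.
  destruct (cycle_has_upper_arc _ _ _ _ H) as [f [a [b [Hf Hon]]]].
  pose proof (arc_left _ _ _ _ Hf) as Ha.
  pose proof (arc_right _ _ _ _ Hf) as Hb.
  destruct Huv as [Hv|[-> Hu]].
  - (* A multiple of [(u, v)] above the arc: at [a] and [b] the arc has height 0,
       and on the vertical axis any height above [f 0] will do. *)
    assert (Hm0 : exists m0, 0 < m0 /\ f (m0 * u) < m0 * v).
    { destruct (Rtotal_order u 0) as [Hu|[->|Hu]].
      - assert (0 < a / u).
        { replace (a / u) with (- a / - u) by (field; lra).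
          apply Rdiv_lt_0_compat; lra. }
        exists (a / u); split; auto.
        rewrite (arc_zero_left _ _ _ _ Hf); [nra|].
        replace (a / u * u) with a by (field; lra). lra.
      - pose proof (arc_nonneg _ _ _ _ 0 Hf).
        assert (E : (f 0 / v + 1) * v = f 0 + v) by (field; lra).
        assert (0 <= f 0 / v).
        { apply Rmult_le_pos; auto. apply Rlt_le, Rinv_0_lt_compat, Hv. }
        exists (f 0 / v + 1); split; [lra|]. rewrite Rmult_0_r. lra.
      - assert (0 < b / u) by (apply Rdiv_lt_0_compat; lra).
        exists (b / u); split; auto.
        rewrite (arc_zero_right _ _ _ _ Hf); [nra|].
        replace (b / u * u) with b by (field; lra). lra. }
    destruct Hm0 as [m0 [Hm0 Hlt]].
    destruct (ray_meets_arc _ _ _ _ u v m0 Hf Hv Hm0 Hlt) as [m [Hm [Hin E]]].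
    destruct (Hon (m * u)) as [s [Exs Eys]]; [lra|].
    exists (/ m), s. split; [apply Rinv_0_lt_compat; lra|].
    rewrite Exs, Eys, E. split; field; lra.
  - destruct (Rlt_or_le u 0) as [Hneg|Hpos].
    + destruct (Hon a) as [s [Exs Eys]]; [lra|].
      rewrite (arc_zero_left _ _ _ _ Hf) in Eys by lra.
      exists (u / a), s. rewrite Exs, Eys. split; [|split; field; lra].
      replace (u / a) with (- u / - a) by (field; lra).
      apply Rdiv_lt_0_compat; lra.
    + destruct (Hon b) as [s [Exs Eys]]; [lra|].
      rewrite (arc_zero_right _ _ _ _ Hf) in Eys by lra.
      exists (u / b), s. rewrite Exs, Eys. split; [|split; field; lra].
      apply Rdiv_lt_0_compat; lra.
Qed.

Lemma cycle_meets_ray phi T x y u v :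
  cycle phi T x y -> u <> 0 \/ v <> 0 ->
  exists k s, 0 < k /\ u = k * x s /\ v = k * y s.
Proof.
  intros H Huv.
  destruct (Rlt_or_le v 0) as [Hv|Hv].
  - destruct (cycle_meets_upper_ray _ _ _ _ (- u) (- v)
                (cycle_central_symmetry _ _ _ _ H)) as [k [s [Hk [E1 E2]]]].
    + left; lra.
    + exists k, s; repeat split; auto; lra.
  - apply (cycle_meets_upper_ray _ _ _ _ u v H).
    destruct (Req_dec v 0); [right|left]; [|lra]. tauto.
Qed.

(** Bounding the ratio by 1 in both directions makes it equal to 1, so the point
    where a ray meets the first cycle is the given point of the second. *)
Lemma cycle_subset phi T1 T2 x1 y1 x2 y2 :
  jointly_continuous phi ->
  radially_increasing phi \/ radially_increasing (fun u v => - phi u v) ->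
  cycle phi T1 x1 y1 -> cycle phi T2 x2 y2 ->
  forall t, exists s, x1 s = x2 t /\ y1 s = y2 t.
Proof.
  intros Hcont Hphi H1 H2 t.
  destruct (cycle_meets_ray _ _ _ _ (x2 t) (y2 t) H1) as [k [s [Hk [Ex Ey]]]].
  { pose proof (cycle_nonzero _ _ _ _ H2 t). tauto. }
  pose proof (ray_ratio_le_one _ _ _ _ _ _ _ Hcont Hphi H1 H2 k s t Hk
                (conj Ex Ey)).
  assert (Hinv : / k <= 1).
  { apply (ray_ratio_le_one _ _ _ _ _ _ _ Hcont Hphi H2 H1 (/ k) t s).
    - apply Rinv_0_lt_compat, Hk.
    - split; [rewrite Ex|rewrite Ey]; field; lra. }
  assert (Hk1 : k = 1).
  { apply Rle_antisym; auto. apply (Rmult_le_compat_l k) in Hinv; [|lra].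
    rewrite Rinv_r in Hinv; lra. }
  exists s. rewrite Ex, Ey, Hk1. split; ring.
Qed.

(** * The origin is not on a non-constant orbit *)

Lemma gronwall_zero (z dz : R -> R) (a b M : R) :
  a < b -> (forall s, is_derive z s (dz s)) ->
  (forall s, a <= s <= b -> dz s <= M * z s) -> z a = 0 -> z b <= 0.
Proof.
  intros Hab Hz Hle Ha.
  assert (Hexp : forall s, is_derive (fun s => exp (- (M * s))) s
                             (- M * exp (- (M * s)))).
  { intros s; auto_derive; [exact I | ring]. }
  assert (Hd : forall s, is_derive (fun s => z s * exp (- (M * s))) s
                 ((dz s - M * z s) * exp (- (M * s)))).
  { intros s. evar_last.
    - apply (is_derive_mult z (fun s => exp (- (M * s))));
        [apply Hz|apply Hexp|intros; apply Rmult_comm].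
    - unfold plus, mult; simpl; ring. }
  destruct (mean_value _ _ a b Hab
    (fun s _ => is_derive_continuous _ _ _ (Hd s)) (fun s _ => Hd s))
    as [c [Hc E]]; cbv beta in E.
  rewrite Ha in E. specialize (Hle c ltac:(lra)).
  pose proof (exp_pos (- (M * c))). pose proof (exp_pos (- (M * b))).
  assert (0 <= (M * z c - dz c) * exp (- (M * c)) * (b - a)).
  { repeat apply Rmult_le_pos; lra. }
  apply Rnot_lt_le; intros Hlt.
  assert (0 < z b * exp (- (M * b))) by (apply Rmult_lt_0_compat; lra).
  lra.
Qed.

(** With [z = x^2 + y^2] one has [z' = - 2 y^2 phi], hence [|z'| <= 2 M z] where
    [M] bounds [|phi|] along the orbit between the two times, and [z] stays 0
    once it is 0, in both directions of time. *)
Lemma origin_is_rest phi (x y : R -> R) t0 t :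
  jointly_continuous phi ->
  (forall t, is_derive x t (y t)) ->
  (forall t, is_derive y t (- x t - y t * phi (x t) (y t))) ->
  x t0 = 0 -> y t0 = 0 -> x t = 0 /\ y t = 0.
Proof.
  intros Hcont Hx Hy Ex Ey.
  assert (Hxc : forall s, continuous x s)
    by (intros s; apply (is_derive_continuous _ _ _ (Hx s))).
  assert (Hyc : forall s, continuous y s)
    by (intros s; apply (is_derive_continuous _ _ _ (Hy s))).
  destruct (Req_dec t0 t) as [<-|Hne]; auto.
  set (z := fun s => x s * x s + y s * y s).
  set (dz := fun s => - (2 * (y s * y s) * phi (x s) (y s))).
  assert (Hz : forall s, is_derive z s (dz s)).
  { intros s. unfold z, dz. evar_last.
    - apply (is_derive_plus (fun s => x s * x s) (fun s => y s * y s)).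
      + apply (is_derive_mult x x); [apply Hx|apply Hx|intros; apply Rmult_comm].
      + apply (is_derive_mult y y); [apply Hy|apply Hy|intros; apply Rmult_comm].
    - unfold plus, mult; simpl; ring. }
  pose proof (Rmin_l t0 t). pose proof (Rmin_r t0 t).
  pose proof (Rmax_l t0 t). pose proof (Rmax_r t0 t).
  destruct (continuity_ab_maj (fun s => Rabs (phi (x s) (y s)))
              (Rmin t0 t) (Rmax t0 t)) as [sm [Hmax _]]; [lra| |].
  { intros c _. apply continuity_pt_filterlim.
    apply (continuous_comp (fun s => phi (x s) (y s)) Rabs).
    - apply continuous_along; auto.
    - apply continuous_Rabs. }
  cbv beta in Hmax. set (M := Rabs (phi (x sm) (y sm))) in *.
  assert (Hbound : forall s, Rmin t0 t <= s <= Rmax t0 t ->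
            dz s <= 2 * M * z s /\ - dz s <= 2 * M * z s).
  { intros s Hs. specialize (Hmax s Hs).
    assert (- M <= phi (x s) (y s) <= M) as [B1 B2].
    { revert Hmax; unfold Rabs at 1; destruct Rcase_abs; lra. }
    assert (0 <= y s * y s) by nra. assert (0 <= x s * x s) by nra.
    assert (0 <= M) by apply Rabs_pos.
    unfold dz, z. split; nra. }
  assert (Hzt : z t <= 0).
  { assert (Ez : z t0 = 0) by (unfold z; rewrite Ex, Ey; ring).
    destruct (Rlt_or_le t0 t) as [Hlt|Hlt].
    - apply (gronwall_zero z dz t0 t (2 * M)); auto.
      intros s Hs; apply Hbound; lra.
    - rewrite <- (Ropp_involutive t).
      apply (gronwall_zero (fun s => z (- s)) (fun s => - dz (- s))
               (- t0) (- t) (2 * M)); try lra.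
      + intros s. evar_last.
        * apply (is_derive_comp z (fun s => - s)); [apply Hz|].
          auto_derive; [exact I|reflexivity].
        * unfold scal; simpl; unfold mult; simpl; ring.
      + intros s Hs; apply Hbound; lra.
      + rewrite Ropp_involutive; auto. }
  unfold z in Hzt. split; nra.
Qed.

Lemma periodic_orbit_cycle phi C :
  jointly_continuous phi -> periodic_orbit (vector_field phi) C ->
  (exists p q, C p /\ C q /\ p <> q) ->
  exists T x y, cycle phi T x y /\
    forall p, C p <-> exists t, (x t, y t) = p.
Proof.
  intros Hcont [g [T [HT [Hsol [Hper HC]]]]] Hnc.
  assert (Hx : forall t, is_derive (fun s => fst (g s)) t (snd (g t))).
  { intros t. eapply filterdiff_ext_lin.
    - apply (filterdiff_comp' g fst t _ fst (Hsol t)).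
      apply filterdiff_linear, is_linear_fst.
    - reflexivity. }
  assert (Hy : forall t, is_derive (fun s => snd (g s)) t
                 (- fst (g t) - snd (g t) * phi (fst (g t)) (snd (g t)))).
  { intros t. eapply filterdiff_ext_lin.
    - apply (filterdiff_comp' g snd t _ snd (Hsol t)).
      apply filterdiff_linear, is_linear_snd.
    - reflexivity. }
  exists T, (fun s => fst (g s)), (fun s => snd (g s)). split.
  - split; auto.
    + intros t; now rewrite Hper.
    + intros t; now rewrite Hper.
    + intros t Ex Ey.
      pose proof (fun s => origin_is_rest phi _ _ t s Hcont Hx Hy Ex Ey) as Hrest.
      destruct Hnc as [p [q [Hp [Hq Hpq]]]]. apply Hpq.
      apply HC in Hp; apply HC in Hq.
      destruct Hp as [s <-]; destruct Hq as [r <-].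
      destruct (Hrest s), (Hrest r). apply injective_projections; simpl in *; congruence.
  - intros p; rewrite HC.
    split; intros [t E]; exists t; rewrite <- E; destruct (g t); auto.
Qed.

(** * Star-shaped functions are monotone along rays *)

Lemma C1_plane_filterdiff phi x y :
  C1_plane phi ->
  filterdiff (fun p : R * R => phi (fst p) (snd p)) (locally (x, y))
    (fun p : R * R => plus (scal (fst p) (Derive (fun u => phi u y) x))
                           (scal (snd p) (Derive (fun v => phi x v) y))).
Proof.
  intros H.
  apply (is_derive_filterdiff phi x y
           (fun u v => Derive (fun w => phi w v) u)).
  - apply filter_forall. intros [u v]. apply Derive_correct, (H u v).
  - apply Derive_correct, (H x y).
  - exact (proj1 (continuity_2d_pt_filterlim
      (fun u v => Derive (fun w => phi w v) u) x y)
      (proj1 (proj2 (proj2 (H x y))))).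
Qed.

Lemma C1_plane_continuous phi : C1_plane phi -> jointly_continuous phi.
Proof.
  intros H [x y].
  apply (filterdiff_continuous (fun p : R * R => phi (fst p) (snd p))).
  eexists; apply (C1_plane_filterdiff phi x y H).
Qed.

Definition radial_slope (phi : R -> R -> R) (x y : R) : R :=
  x * Derive (fun u => phi u y) x + y * Derive (fun v => phi x v) y.

Lemma is_derive_along_ray phi x y k :
  C1_plane phi -> 0 < k ->
  is_derive (fun r => phi (r * x) (r * y)) k
    (radial_slope phi (k * x) (k * y) / k).
Proof.
  intros H Hk.
  assert (Hlin : forall c, is_derive (fun r => r * c) k c).
  { intros c; auto_derive; [exact I|ring]. }
  eapply filterdiff_ext_lin.
  - apply (filterdiff_comp'_2 (fun r => r * x) (fun r => r * y) phi k _ _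
             (fun a b => plus (scal a (Derive (fun u => phi u (k * y)) (k * x)))
                              (scal b (Derive (fun v => phi (k * x) v) (k * y))))
             (Hlin x) (Hlin y) (C1_plane_filterdiff phi (k * x) (k * y) H)).
  - intros r. unfold radial_slope, plus, scal; simpl; unfold mult; simpl.
    field; lra.
Qed.

Lemma radial_slope_continuous phi :
  C1_plane phi -> jointly_continuous (radial_slope phi).
Proof.
  intros H [x y]. unfold radial_slope. destruct (H x y) as [_ [_ [Hx Hy]]].
  apply continuity_2d_pt_filterlim in Hx.
  apply continuity_2d_pt_filterlim in Hy.
  apply (continuous_plus
    (fun q : R * R => fst q * Derive (fun u => phi u (snd q)) (fst q))
    (fun q : R * R => snd q * Derive (fun v => phi (fst q) v) (snd q))).
  - apply (continuous_mult (fun q : R * R => fst q)); [apply continuous_fst|].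
    exact Hx.
  - apply (continuous_mult (fun q : R * R => snd q)); [apply continuous_snd|].
    exact Hy.
Qed.

Lemma same_sign_on_segment (S : R -> R -> R) x0 y0 x1 y1 :
  jointly_continuous S ->
  (forall m, 0 <= m <= 1 ->
     S (x0 + m * (x1 - x0)) (y0 + m * (y1 - y0)) <> 0) ->
  0 < S x0 y0 * S x1 y1.
Proof.
  intros HS Hne.
  set (h := fun m => S (x0 + m * (x1 - x0)) (y0 + m * (y1 - y0))).
  assert (Hh : forall m, continuous h m).
  { intros m. apply continuous_along; auto.
    - apply (is_derive_continuous _ _ (x1 - x0)). auto_derive; [exact I|ring].
    - apply (is_derive_continuous _ _ (y1 - y0)). auto_derive; [exact I|ring]. }
  assert (E0 : h 0 = S x0 y0) by (unfold h; f_equal; ring).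
  assert (E1 : h 1 = S x1 y1) by (unfold h; f_equal; ring).
  rewrite <- E0, <- E1.
  pose proof (Hne 0 ltac:(lra)) as N0. pose proof (Hne 1 ltac:(lra)) as N1.
  fold (h 0) in N0; fold (h 1) in N1.
  destruct (Rtotal_order (h 0 * h 1) 0) as [Hlt|[Heq|]]; auto; exfalso.
  - destruct (intermediate_zero h 0 1) as [c [Hc Ec]]; auto; [lra|].
    apply (Hne c); [lra|exact Ec].
  - apply Rmult_integral in Heq; tauto.
Qed.

(** The punctured plane is connected by segments: from [(1, 0)] every point off
    the [x]-axis is visible, and [(0, 1)] sees the points of that axis. *)
Lemma nonvanishing_same_sign (S : R -> R -> R) :
  jointly_continuous S -> (forall x y, x <> 0 \/ y <> 0 -> S x y <> 0) ->
  forall x y, x <> 0 \/ y <> 0 -> 0 < S 1 0 * S x y.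
Proof.
  intros HS Hne.
  assert (Hoff : forall x y, y <> 0 -> 0 < S 1 0 * S x y).
  { intros x y Hy. apply same_sign_on_segment; auto.
    intros m Hm. apply Hne.
    destruct (Req_dec m 0) as [->|]; [left; lra|right].
    replace (0 + m * (y - 0)) with (m * y) by ring.
    now apply Rmult_integral_contrapositive_currified. }
  intros x y Hxy. destruct (Req_dec y 0) as [->|Hy]; auto.
  assert (Hx : x <> 0) by tauto.
  assert (H1 : 0 < S 1 0 * S 0 1) by (apply Hoff; lra).
  assert (H2 : 0 < S 0 1 * S x 0).
  { apply same_sign_on_segment; auto. intros m Hm. apply Hne.
    destruct (Req_dec m 1) as [->|]; [left|right]; lra. }
  assert (0 < (S 1 0 * S 0 1) * (S 0 1 * S x 0)) by (apply Rmult_lt_0_compat; auto).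
  assert (0 <= S 0 1 * S 0 1) by nra.
  nra.
Qed.

Lemma star_shaped_radially_monotone phi :
  C1_plane phi -> strictly_star_shaped phi ->
  radially_increasing phi \/ radially_increasing (fun u v => - phi u v).
Proof.
  intros H Hstar.
  assert (Hne : forall x y, x <> 0 \/ y <> 0 -> radial_slope phi x y <> 0).
  { intros x y Hxy. apply Hstar. intros E; inversion E; tauto. }
  pose proof (nonvanishing_same_sign _ (radial_slope_continuous phi H) Hne) as Hs.
  assert (Hgrow : forall x y k, 1 < k -> exists c, 1 < c /\
            phi (k * x) (k * y) - phi x y
              = radial_slope phi (c * x) (c * y) / c * (k - 1)).
  { intros x y k Hk.
    destruct (mean_value (fun r => phi (r * x) (r * y))
      (fun r => radial_slope phi (r * x) (r * y) / r) 1 k Hk) as [c [Hc E]].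
    - intros r Hr. eapply is_derive_continuous, is_derive_along_ray; auto; lra.
    - intros r Hr. apply is_derive_along_ray; auto; lra.
    - rewrite !Rmult_1_l in E. exists c; split; [lra|auto]. }
  assert (Hscale : forall x y c, 1 < c -> x <> 0 \/ y <> 0 ->
            c * x <> 0 \/ c * y <> 0).
  { intros x y c Hc [|]; [left|right];
      apply Rmult_integral_contrapositive_currified; auto; lra. }
  destruct (Rlt_or_le 0 (radial_slope phi 1 0)) as [Hpos|Hneg]; [left|right];
    intros x y k Hxy Hk; destruct (Hgrow x y k Hk) as [c [Hc E]];
    pose proof (Hs _ _ (Hscale x y c Hc Hxy)) as Hsc;
    assert (0 < / c) by (apply Rinv_0_lt_compat; lra);
    set (r := radial_slope phi (c * x) (c * y)) in *.
  - assert (0 < r) by nra.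
    assert (0 < r / c * (k - 1)) by (repeat apply Rmult_lt_0_compat; lra). lra.
  - assert (0 < - r) by nra.
    assert (0 < - r / c * (k - 1)) by (repeat apply Rmult_lt_0_compat; lra).
    unfold Rdiv in *. lra.
Qed.

(** * Uniqueness of the limit cycle *)

Theorem theorem1 (phi : R -> R -> R)
  (hC1 : C1_plane phi) (hstar : strictly_star_shaped phi)
  (C1 C2 : R * R -> Prop)
  (h1 : limit_cycle (vector_field phi) C1)
  (h2 : limit_cycle (vector_field phi) C2) :
  forall p : R * R, C1 p <-> C2 p.
Proof.
  pose proof (C1_plane_continuous phi hC1) as Hcont.
  pose proof (star_shaped_radially_monotone phi hC1 hstar) as Hmono.
  destruct h1 as [P1 [N1 _]]; destruct h2 as [P2 [N2 _]].
  destruct (periodic_orbit_cycle phi C1 Hcont P1 N1) as [T1 [x1 [y1 [H1 E1]]]].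
  destruct (periodic_orbit_cycle phi C2 Hcont P2 N2) as [T2 [x2 [y2 [H2 E2]]]].
  intros p; rewrite E1, E2. split; intros [t <-].
  - destruct (cycle_subset _ _ _ _ _ _ _ Hcont Hmono H2 H1 t) as [s [Ex Ey]].
    exists s; now rewrite Ex, Ey.
  - destruct (cycle_subset _ _ _ _ _ _ _ Hcont Hmono H1 H2 t) as [s [Ex Ey]].
    exists s; now rewrite Ex, Ey.
Qed.
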